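(* Let $n\ge 1$ and $r\ge 1$ be integers and let $q_1,\dots,q_n$ be real numbers with $q_i\ge 0$ for all $1\le i\le n$. Then the multivariate $\mathbf{q}$-Eulerian polynomial for the generalized symmetric group $G_n^r$, defined as $$G_n^r(\mathbf{x},\mathbf{y};\mathbf{q})=\sum_{\sigma\in G_n^r}\mathbf{q}^{\mathcal{N}(\sigma)}\prod_{i\in\mathcal{DT}_r(\sigma)}x_i\prod_{i\in\mathcal{AT}_r(\sigma)}y_i\ \in\ \mathbb{R}[x_1,\dots,x_n,y_1,\dots,y_n],$$ is stable.
   Context: A polynomial $f\in\mathbb{R}[z_1,\dots,z_m]$ is called (real) stable if $f\equiv 0$ or $f(z_1,\dots,z_m)\ne 0$ whenever all $z_j\in\mathbb{C}$ have strictly positive imaginary part. $G_n^r=\mathbb{Z}_r\wr \mathrm{Sym}(n)$ is the set of $r$-colored permutations: sequences $\sigma=(\zeta^{e_1}\tau_1,\dots,\zeta^{e_n}\tau_n)$, where $\tau=\tau_1\cdots\tau_n$ is a permutation of $[n]=\{1,\dots,n\}$, $e_i\in\{0,1,\dots,r-1\}$, and $\zeta$ is a generator of the cyclic group $\mathbb{Z}_r$ of order $r$ (so $\zeta^{e}k$ denotes the letter $k$ with color $e$; write $\zeta^0k=k$). Put $|\zeta^{e}k|=k$, $|0|=0$, and $\sigma_0=0$, $\sigma_i=\zeta^{e_i}\tau_i$. Colored letters together with $0$ are totally ordered by $$\zeta^{r-1}n<\dots<\zeta n<\dots<\zeta^{r-1}2<\dots<\zeta 2<\zeta^{r-1}1<\dots<\zeta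 1<0<1<2<\dots<n.$$ With respect to this order, $$\mathcal{DT}_r(\sigma)=\{\max(|\sigma_i|,|\sigma_{i+1}|):0\le i\le n-1,\ \sigma_i>\sigma_{i+1}\},$$ $$\mathcal{AT}_r(\sigma)=\{\max(|\sigma_i|,|\sigma_{i+1}|):0\le i\le n-1,\ \sigma_i<\sigma_{i+1}\}.$$ $\mathcal{N}(\sigma)$ is the multiset in which each $i\in[n]$ appears $e_i$ times, so that $\mathbf{q}^{\mathcal{N}(\sigma)}=\prod_{i=1}^n q_i^{e_i}$ (with the convention $0^0=1$).
   Formalization: The exponent of q_i is the color carried by the letter i in σ, not the color e_i at position i; with position colors the claim fails (n=3, r=2, q=(1,0,1)). The two agree for n≤2, r=1, or all q_i equal. *)

(* Defs.v *)
From HB Require Import structures.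
From mathcomp Require Import all_boot all_order all_fingroup all_algebra.
From mathcomp Require Import reals complex mpoly.

Set Implicit Arguments.
Unset Strict Implicit.
Unset Printing Implicit Defensive.

Import Order.TTheory GRing.Theory Num.Theory.

Local Open Scope ring_scope.

Definition real_stable (R : realType) (m : nat) (f : {mpoly R[m]}) : Prop :=
  f = 0 \/
  forall z : 'I_m -> R[i],
    (forall j, 0 < complex.Im (z j)) -> (map_mpoly (real_complex R) f).@[z] != 0.

(* The pair (s, e) is the colored word whose letter at position i is
   zeta^(e i) (s i); positions and letters are both shifted down by one. *)
Definition colored_perm (n r : nat) : finType :=
  ('S_n * {ffun 'I_n -> 'I_r})%type.

(* (e, k) stands for zeta^e k, and (0, 0) for the extra letter 0. *)
Definition letter : Type := (nat * nat)%type.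

Definition abs_letter (a : letter) : nat := a.2.

Definition lt_letter (a b : letter) : bool :=
  match a.1, b.1 with
  | 0%N, 0%N => (a.2 < b.2)%N
  | 0%N, _.+1 => false
  | _.+1, 0%N => true
  | _.+1, _.+1 => (b.2 < a.2)%N || (a.2 == b.2) && (b.1 < a.1)%N
  end.

Section ColoredPermutationStatistics.

Variables n r : nat.
Implicit Type sigma : colored_perm n r.

(* The letter sigma_i, for i = 0, ..., n, with sigma_0 = 0. *)
Definition letter_at sigma (i : 'I_n.+1) : letter :=
  if unlift ord0 i is Some j then (nat_of_ord (sigma.2 j), (sigma.1 j).+1)
  else (0%N, 0%N).

Definition cur_letter sigma (i : 'I_n) : letter :=
  letter_at sigma (widen_ord (leqnSn n) i).

Definition next_letter sigma (i : 'I_n) : letter :=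
  letter_at sigma (lift ord0 i).

Definition max_abs sigma (i : 'I_n) : nat :=
  maxn (abs_letter (cur_letter sigma i)) (abs_letter (next_letter sigma i)).

(* The element k : 'I_n represents the number k.+1 of {1, ..., n}. *)
Definition descent_tops sigma : {set 'I_n} :=
  [set k : 'I_n | [exists i : 'I_n,
     lt_letter (next_letter sigma i) (cur_letter sigma i) &&
     (max_abs sigma i == k.+1)]].

Definition ascent_tops sigma : {set 'I_n} :=
  [set k : 'I_n | [exists i : 'I_n,
     lt_letter (cur_letter sigma i) (next_letter sigma i) &&
     (max_abs sigma i == k.+1)]].

(* The multiplicity of k in N(sigma) is the exponent e for which zeta^e k
   occurs in sigma, i.e. the color carried by the letter k, wherever it is
   placed (as opposed to the color found at position k). *)
Definition color_mult sigma (k : 'I_n) : nat := sigma.2 ((sigma.1)^-1%g k).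

End ColoredPermutationStatistics.

(* The variables x_k and y_k are the first n and the last n indeterminates. *)
Definition Eulerian_poly (R : realType) (n r : nat) (q : 'I_n -> R) :
    {mpoly R[n + n]} :=
  \sum_(sigma : colored_perm n r)
    (\prod_(k < n) q k ^+ color_mult sigma k) *:
    ((\prod_(k in descent_tops sigma) 'X_(lshift n k)) *
     (\prod_(k in ascent_tops sigma) 'X_(rshift n k))).

(* Main.v *)
(** Every colored permutation of [n+1] arises uniquely by inserting the letter
    zeta^e (n+1) into one of [n].  Each step of the path 0, sigma_1, ..., sigma_n
    contributes one variable; an insertion inside a step replaces its variable
    by x_(n+1) y_(n+1), whatever e is, and an insertion at the end adds the
    factor y_(n+1) if e = 0 and x_(n+1) otherwise.  With
    Q = q_(n+1) + ... + q_(n+1)^(r-1) and D the sum of all partial derivatives,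
      G_(n+1) = (y_(n+1) + Q x_(n+1)) G_n + (1 + Q) x_(n+1) y_(n+1) D G_n.
    Dividing by x_(n+1) y_(n+1) G_n, it is enough that
      1/x_(n+1) + Q/y_(n+1) + (1 + Q) (D G_n)/G_n
    has negative imaginary part on the upper half-plane.  The last quotient is
    the logarithmic derivative at t = 0 of t |-> G_n(x + t, y + t), whose roots
    all lie in the lower half-plane by induction, so its imaginary part is
    nonpositive. *)

Require Import Defs.
From mathcomp Require Import all_boot all_order all_fingroup all_algebra.
From mathcomp Require Import reals complex mpoly.
From mathcomp Require Import ring lra zify.

Import Order.TTheory GRing.Theory Num.Theory.

Set Implicit Arguments.
Unset Strict Implicit.
Unset Printing Implicit Defensive.

Local Open Scope ring_scope.

(** * Inserting the largest letter into a word *)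

(** A letter of larger absolute value lies above all smaller ones if it has color 0 and below them
    otherwise, so its color alone decides the comparison. *)
Lemma lt_letter_max_right (a b : letter) : (a.2 < b.2)%N ->
  lt_letter a b = (b.1 == 0)%N.
Proof.
case: a b => [[|c] k] [[|d] l] //= lt_kl; rewrite /lt_letter /=.
by rewrite ltnNge ltnW //= ltn_eqF.
Qed.

Lemma lt_letter_max_left (a b : letter) : (a.2 < b.2)%N ->
  lt_letter b a = (b.1 != 0)%N.
Proof.
case: a b => [[|c] k] [[|d] l] //= lt_kl; rewrite /lt_letter /= ?lt_kl //.
by rewrite ltnNge ltnW.
Qed.

Section Words.

(* The weights are indexed by the letters 1, 2, ..., hence q 0, x 0 and y 0
   never matter. *)
Variables (K : comNzRingType) (q x y : nat -> K).
Implicit Types (a b : letter) (w : seq letter).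

Definition edge_weight a b : K :=
  if lt_letter a b then y (maxn a.2 b.2) else x (maxn a.2 b.2).

Fixpoint path_weight a w : K :=
  if w is b :: w' then edge_weight a b * path_weight b w' else 1.

(** The operator D on [path_weight]: every edge weight is a single variable, so the Leibniz rule
    deletes one edge weight at a time. *)
Fixpoint path_deriv a w : K :=
  if w is b :: w' then path_weight b w' + edge_weight a b * path_deriv b w'
  else 0.

Definition color_weight w : K := \prod_(a <- w) q a.2 ^+ a.1.

Definition insert_letter w (p : nat) b : seq letter := take p w ++ b :: drop p w.

Lemma path_weight_nth a w :
  path_weight a w =
  \prod_(i < size w) edge_weight (nth a (a :: w) i) (nth a w i).
Proof.
elim: w a => [|b w IHw] a /=; first by rewrite big_ord0.
rewrite big_ord_recl /= IHw; congr (_ * _); apply: eq_bigr => i _.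
rewrite add0n; congr (edge_weight _ _); last exact: set_nth_default.
by apply: set_nth_default => /=; rewrite ltnS ltnW.
Qed.

Lemma edge_weight_max_right a e m : (a.2 < m)%N ->
  edge_weight a (e, m) = if e == 0 then y m else x m.
Proof.
by move=> lt_am; rewrite /edge_weight lt_letter_max_right // (maxn_idPr (ltnW _)).
Qed.

Lemma edge_weight_max_left a e m : (a.2 < m)%N ->
  edge_weight (e, m) a = if e == 0 then x m else y m.
Proof.
move=> lt_am; rewrite /edge_weight lt_letter_max_left // (maxn_idPl (ltnW _)) //.
by rewrite if_neg.
Qed.

(* Placing the largest letter inside an edge replaces the weight of that edge
   by x m * y m, and the weights of the other edges survive. *)
Lemma sum_path_weight_insert a w e m :
    (a.2 < m)%N -> all (fun b => b.2 < m)%N w ->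
  \sum_(p < (size w).+1) path_weight a (insert_letter w p (e, m)) =
  (if e == 0 then y m else x m) * path_weight a w + x m * y m * path_deriv a w.
Proof.
elim: w a => [|b w IHw] a lt_am /=.
  by move=> _; rewrite big_ord1 /= edge_weight_max_right //; ring.
(* Position 0 splits the edge from [a] to [b] into two edges of weights [x m] and [y m], in an order
   decided by [e]; all other positions keep that edge. *)
case/andP=> lt_bm w_m; rewrite big_ord_recl /=.
rewrite edge_weight_max_right // edge_weight_max_left //.
under eq_bigr => i _ do rewrite add0n.
rewrite -mulr_sumr (IHw b) //.
by case: (e == 0); ring.
Qed.

Lemma color_weight_insert w p e m :
  color_weight (insert_letter w p (e, m)) = q m ^+ e * color_weight w.
Proof.
rewrite /color_weight -{2}(cat_take_drop p w) !big_cat big_cons /=.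
by rewrite mulrCA.
Qed.

Definition word n r (sigma : colored_perm n r) : seq letter :=
  [seq (nat_of_ord (sigma.2 j), (sigma.1 j).+1) | j <- enum 'I_n].

Definition word_sum (n r : nat) : K :=
  \sum_(sigma : colored_perm n r)
    color_weight (word sigma) * path_weight (0, 0) (word sigma).

Definition word_sum_deriv (n r : nat) : K :=
  \sum_(sigma : colored_perm n r)
    color_weight (word sigma) * path_deriv (0, 0) (word sigma).

End Words.

Lemma size_word n r (sigma : colored_perm n r) : size (word sigma) = n.
Proof. by rewrite size_map size_enum_ord. Qed.

Lemma nth_word n r (sigma : colored_perm n r) a (j : 'I_n) :
  nth a (word sigma) j = (nat_of_ord (sigma.2 j), (sigma.1 j).+1).
Proof.
by rewrite (nth_map j) ?size_enum_ord // nth_ord_enum.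
Qed.

Lemma word_lt n r (sigma : colored_perm n r) :
  all (fun b => b.2 < n.+1)%N (word sigma).
Proof. by apply/allP => _ /mapP[j _ ->]; rewrite /= ltnS. Qed.

(** * Insertion as a bijection on colored permutations *)

Section Insertion.

Variables n r : nat.

Definition insert_max (u : colored_perm n r * ('I_n.+1 * 'I_r)) :
    colored_perm n.+1 r :=
  (lift_perm u.2.1 ord_max u.1.1,
   [ffun i => if unlift u.2.1 i is Some j then u.1.2 j else u.2.2]).

Lemma insert_max_inj : injective insert_max.
Proof.
move=> [[s c] [p e]] [[s' c'] [p' e']] /= [eq_s /ffunP eq_c].
(* The position [p] is recovered as the place of the largest letter. *)
have eq_p : p = p'.
  apply: (@perm_inj _ (lift_perm p ord_max s)).
  by rewrite lift_perm_id eq_s lift_perm_id.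
rewrite -{p'}eq_p in eq_s eq_c *.
have -> : e = e' by have := eq_c p; rewrite !ffunE unlift_none.
have -> : s = s'.
  apply/permP => j; apply: (@lift_inj _ ord_max).
  by rewrite -!(lift_perm_lift p) eq_s.
suff -> : c = c' by [].
by apply/ffunP => j; have := eq_c (lift p j); rewrite !ffunE liftK.
Qed.

Lemma insert_max_bij : bijective insert_max.
Proof.
apply: (inj_card_bij insert_max_inj).
rewrite !card_prod !card_ffun !card_ord !card_Sn factS expnS.
by rewrite leq_eqVlt; apply/orP; left; apply/eqP; ring.
Qed.

Lemma word_insert_max u :
  word (insert_max u) =
  insert_letter (word u.1) u.2.1 (nat_of_ord u.2.2, n.+1).
Proof.
case: u => [[s c] [p e]] /=; have le_pn : (p <= n)%N by rewrite -ltnS.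
apply: (@eq_from_nth _ (0, 0)%N) => [|i].
  rewrite size_word size_cat /= size_take size_drop size_word.
  by case: ltnP; lia.
rewrite size_word => lt_in; rewrite (nth_word _ _ (Ordinal lt_in)) /=.
rewrite ffunE /insert_letter nth_cat size_takel ?size_word //.
case: unliftP => [j|] def_i.
  rewrite def_i lift_perm_lift lift_max; have -> : i = lift p j by rewrite -def_i.
  rewrite /= /bump.
  case: (leqP p j) => le_pj; rewrite ?add1n ?add0n.
    rewrite ltnNge leqW //= subSn //= nth_drop subnKC //.
    by rewrite (nth_word (s, c)).
  by rewrite le_pj nth_take // (nth_word (s, c)).
rewrite def_i lift_perm_id; have -> : i = p by rewrite -def_i.
by rewrite ltnn subnn.
Qed.

End Insertion.

Lemma word_sumS (K : comNzRingType) (q x y : nat -> K) n r :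
  word_sum q x y n.+1 r =
  (\sum_(e < r) q n.+1 ^+ e * (if e == 0 :> nat then y n.+1 else x n.+1))
    * word_sum q x y n r
  + (\sum_(e < r) q n.+1 ^+ e) * (x n.+1 * y n.+1) * word_sum_deriv q x y n r.
Proof.
rewrite /word_sum (reindex (@insert_max n r)) /=; last first.
  exact: onW_bij (insert_max_bij n r).
rewrite -(pair_bigA _ (fun u v => color_weight q (word (insert_max (u, v))) *
  path_weight x y (0, 0)%N (word (insert_max (u, v))))) /=.
rewrite /word_sum_deriv !mulr_sumr -big_split /=; apply: eq_bigr => u _.
rewrite -(pair_bigA _ (fun p e => color_weight q (word (insert_max (u, (p, e)))) *
  path_weight x y (0, 0)%N (word (insert_max (u, (p, e)))))) /=.
rewrite exchange_big /= !mulr_suml -big_split /=; apply: eq_bigr => e _.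
under eq_bigr => p _ do rewrite word_insert_max color_weight_insert /=.
have := @sum_path_weight_insert _ x y (0, 0)%N _ e _ (ltn0Sn n) (word_lt u).
by rewrite -mulr_sumr size_word => ->; ring.
Qed.

Lemma word_sum0 (K : comNzRingType) (q x y : nat -> K) r :
  word_sum q x y 0 r = 1.
Proof.
rewrite /word_sum (big_pred1 (1%g, [ffun i => ffun0 (card_ord 0) i])) => [|u].
  by rewrite /word enum_ord0 /color_weight big_nil mulr1.
apply/esym/eqP; case: u => s c; congr (_, _); first by apply/permP => -[].
by apply/ffunP => -[].
Qed.

(** * Shifting all variables by a common t *)

Section Translation.

Variables (K : comNzRingType) (q x y : nat -> K).

Let qP k := (q k)%:P.
Let xP k := (x k)%:P + 'X.
Let yP k := (y k)%:P + 'X.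

Lemma horner_edge_weight a b t :
  (edge_weight xP yP a b).[t] =
  edge_weight (fun k => x k + t) (fun k => y k + t) a b.
Proof. by rewrite /edge_weight; case: ifP; rewrite !hornerE. Qed.

Lemma horner_path_weight a w t :
  (path_weight xP yP a w).[t] =
  path_weight (fun k => x k + t) (fun k => y k + t) a w.
Proof.
by elim: w a => [|b w IHw] a /=; rewrite hornerE // horner_edge_weight IHw.
Qed.

Lemma deriv_edge_weight a b : (edge_weight xP yP a b)^`() = 1.
Proof. by rewrite /edge_weight; case: ifP; rewrite derivE derivC derivX add0r. Qed.

Lemma deriv_path_weight a w :
  (path_weight xP yP a w)^`() = path_deriv xP yP a w.
Proof.
elim: w a => [|b w IHw] a /=; first by rewrite derivC.
by rewrite derivM deriv_edge_weight mul1r IHw.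
Qed.

Lemma horner_path_deriv a w t :
  (path_deriv xP yP a w).[t] =
  path_deriv (fun k => x k + t) (fun k => y k + t) a w.
Proof.
elim: w a => [|b w IHw] a /=; rewrite hornerE //.
by rewrite hornerM horner_edge_weight IHw horner_path_weight.
Qed.

Lemma color_weightC w : color_weight qP w = (color_weight q w)%:P.
Proof.
by rewrite /color_weight rmorph_prod; apply: eq_bigr => a _; rewrite rmorphXn.
Qed.

Lemma horner_word_sum n r t :
  (word_sum qP xP yP n r).[t] =
  word_sum q (fun k => x k + t) (fun k => y k + t) n r.
Proof.
rewrite horner_sum; apply: eq_bigr => u _.
by rewrite hornerM color_weightC hornerC horner_path_weight.
Qed.

(** Along the common shift each edge weight has derivative 1, so D becomes the derivative in one
    variable; [t] = 0 gives D G_n itself. *)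
Lemma horner_deriv_word_sum n r t :
  (word_sum qP xP yP n r)^`().[t] =
  word_sum_deriv q (fun k => x k + t) (fun k => y k + t) n r.
Proof.
rewrite linear_sum horner_sum; apply: eq_bigr => u _ /=.
rewrite color_weightC derivM derivC mul0r add0r hornerM hornerC.
by rewrite deriv_path_weight horner_path_deriv.
Qed.

End Translation.

(** * Nonvanishing on the upper half-plane *)

Section UpperHalfPlane.

Variable R : realType.
Implicit Types (z u : R[i]) (P : {poly R[i]}).

Lemma ImD z u : complex.Im (z + u) = complex.Im z + complex.Im u.
Proof. by case: z u => [a b] [c d]. Qed.

Lemma ImZ (a : R) z : complex.Im (real_complex R a * z) = a * complex.Im z.
Proof. by case: z => b c; rewrite /= mul0r addr0. Qed.

Lemma Im_gt0_neq0 z : 0 < complex.Im z -> z != 0.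
Proof. by apply: contraTneq => ->; rewrite ltxx. Qed.

Lemma Im_inv_lt0 z : 0 < complex.Im z -> complex.Im z^-1 < 0.
Proof.
case: z => a b /= b_gt0; rewrite oppr_lt0 divr_gt0 //.
by rewrite ltr_wpDl ?sqr_ge0 // exprn_gt0.
Qed.

(* P' / P is the sum of the inverses of t - z over the roots z of P. *)
Lemma Im_log_deriv_le0 P (t : R[i]) :
    (forall u, 0 <= complex.Im u -> P.[t + u] != 0) ->
  complex.Im (P^`().[t] / P.[t]) <= 0.
Proof.
have [s ->] := closed_field_poly_normal P; set a := lead_coef P.
have [-> | a_neq0] := eqVneq a 0.
  by move=> _; rewrite scale0r derivC horner0 mul0r.
rewrite derivZ => P_neq0; rewrite !hornerZ -mulf_div divff // mul1r.
have {P_neq0}: forall u, 0 <= complex.Im u -> (\prod_(z <- s) ('X - z%:P)).[t + u] != 0.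
  by move=> u /P_neq0; rewrite hornerZ mulf_eq0 negb_or => /andP[].
elim: s => [|z s IHs]; first by rewrite big_nil derivC horner0 mul0r.
rewrite big_cons => P_neq0.
have [tz_gt0 Q_neq0] : 0 < complex.Im (t - z) /\
    forall u, 0 <= complex.Im u -> (\prod_(z <- s) ('X - z%:P)).[t + u] != 0.
  split=> [|u /P_neq0]; last by rewrite hornerM mulf_eq0 negb_or => /andP[].
  rewrite ltNge; apply/negP => tz_le0.
  (* Otherwise [u] = [z - t] would be admissible and [t + u] would be the root [z]. *)
  have := P_neq0 (z - t); rewrite [t + _]addrC subrK hornerM hornerXsubC subrr mul0r eqxx.
  by move/(_ _)/negP; apply=> //; rewrite -opprB raddfN oppr_ge0.
have Qt_neq0 := Q_neq0 0 (lexx _); rewrite addr0 in Qt_neq0.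
(* The logarithmic derivative splits into the inverse of [t - z] and that of the remaining
   product. *)
rewrite derivM derivXsubC mul1r hornerD !hornerM hornerXsubC mulrDl ImD.
have tz_neq0 := Im_gt0_neq0 tz_gt0.
rewrite -mulf_div divff // mul1r [_ * (\prod_(_ <- _) _).[t]]mulrC.
rewrite -{1}[(\prod_(_ <- _) _).[t]]mulr1 -mulf_div divff // !mul1r.
by have := IHs Q_neq0; have := Im_inv_lt0 tz_gt0; lra.
Qed.

Lemma word_sum_neq0 n r (q : nat -> R) (x y : nat -> R[i]) :
    (0 < r)%N -> (forall k, 0 <= q k) ->
    (forall k, 0 < complex.Im (x k)) -> (forall k, 0 < complex.Im (y k)) ->
  word_sum (fun k => real_complex R (q k)) x y n r != 0.
Proof.
case: r => // r _ q_ge0; elim: n x y => [|n IHn] x y x_gt0 y_gt0.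
  by rewrite word_sum0 oner_neq0.
set qC := fun k => _; rewrite word_sumS.
pose P := word_sum (fun k => (qC k)%:P) (fun k => (x k)%:P + 'X)
                   (fun k => (y k)%:P + 'X) n r.+1.
(* A shift by [u] with nonnegative imaginary part keeps all variables in the upper half-plane, where
   the induction hypothesis applies. *)
have PE u : 0 <= complex.Im u -> P.[0 + u] != 0.
  move=> u_ge0; rewrite add0r horner_word_sum.
  by apply: IHn => k; rewrite ImD ltr_wpDr.
have := Im_log_deriv_le0 PE; have := PE 0 (lexx _); rewrite addr0.
rewrite horner_word_sum horner_deriv_word_sum.
have x0 : (fun k => x k + 0) = x by apply: boolp.funext => k; rewrite addr0.
have y0 : (fun k => y k + 0) = y by apply: boolp.funext => k; rewrite addr0.
rewrite {}x0 {}y0.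
set g := word_sum _ _ _ _ _; set g' := word_sum_deriv _ _ _ _ _ => g_neq0 g'_le0.
pose Q := \sum_(e < r) q n.+1 ^+ e.+1.
have Q_ge0 : 0 <= Q by apply: sumr_ge0 => e _; rewrite exprn_ge0.
rewrite !big_ord_recl /= expr0 mul1r -mulr_suml.
have -> : \sum_(i < r) qC n.+1 ^+ bump 0 i = real_complex R Q.
  by rewrite rmorph_sum; apply: eq_bigr => e _; rewrite rmorphXn.
have -> : 1 + real_complex R Q = real_complex R (1 + Q) by rewrite rmorphD.
have := x_gt0 n.+1; have := y_gt0 n.+1.
move: (x n.+1) (y n.+1) => a b b_gt0 a_gt0.
have [a_neq0 b_neq0] := (Im_gt0_neq0 a_gt0, Im_gt0_neq0 b_gt0).
have -> : (b + real_complex R Q * a) * g + real_complex R (1 + Q) * (a * b) * g' =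
  (a * b * g) *
    (a^-1 + real_complex R Q * b^-1 + real_complex R (1 + Q) * (g' / g)).
  by field; rewrite a_neq0 b_neq0 g_neq0.
(* If the last factor vanished, the imaginary part of [a^-1] would be minus a sum of two nonpositive
   terms, hence nonnegative. *)
rewrite !mulf_neq0 //; apply: contraTneq (Im_inv_lt0 a_gt0) => sum0.
have /(congr1 (@complex.Im R)) := sum0; rewrite !ImD !ImZ /= => sumIm0.
have := mulr_ge0_le0 Q_ge0 (ltW (Im_inv_lt0 b_gt0)).
have := mulr_ge0_le0 (addr_ge0 ler01 Q_ge0) g'_le0.
by rewrite -leNgt; lra.
Qed.

End UpperHalfPlane.

(** * Descent and ascent tops as steps of the word *)

Section EulerianWord.

Variables n r : nat.
Variable sigma : colored_perm n r.

(** The letters sigma_0, ..., sigma_n, with the extra letter 0 at index 0. *)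
Let L k := nth (0, 0)%N ((0, 0)%N :: word sigma) k.

Lemma cur_letterE (i : 'I_n) : cur_letter sigma i = L i.
Proof.
rewrite /cur_letter /letter_at; case: unliftP => [j|] def_i.
  have -> : (i : nat) = j.+1 by have /(congr1 val) := def_i.
  by rewrite /L /= nth_word.
by have -> : (i : nat) = 0%N by have /(congr1 val) := def_i.
Qed.

Lemma next_letterE (i : 'I_n) : next_letter sigma i = L i.+1.
Proof. by rewrite /next_letter /letter_at liftK /L /= nth_word. Qed.

Lemma abs_letter_inj k l : (k <= n)%N -> (l <= n)%N ->
  (L k).2 = (L l).2 -> k = l.
Proof.
case: k l => [|k] [|l] //= lt_kn lt_ln; rewrite /L /=.
- by rewrite (nth_word _ _ (Ordinal lt_ln)).
- by rewrite (nth_word _ _ (Ordinal lt_kn)).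
rewrite (nth_word _ _ (Ordinal lt_kn)) (nth_word _ _ (Ordinal lt_ln)) /=.
by case=> /val_inj/perm_inj[->].
Qed.

Lemma max_absE (i : 'I_n) : max_abs sigma i = maxn (L i).2 (L i.+1).2.
Proof. by rewrite /max_abs cur_letterE next_letterE. Qed.

Lemma abs_letter_neq (i : 'I_n) : (L i).2 != (L i.+1).2.
Proof.
apply/eqP => /abs_letter_inj eq_i.
by have := n_Sn i; rewrite {1}eq_i // ltnW.
Qed.

(** Two distinct steps with the same maximum are those entering and leaving one letter that exceeds
    both neighbours in absolute value; one is then an ascent and the other a descent. *)
Lemma max_abs_inj (i j : 'I_n) :
    lt_letter (cur_letter sigma i) (next_letter sigma i) =
      lt_letter (cur_letter sigma j) (next_letter sigma j) ->
  max_abs sigma i = max_abs sigma j -> i = j.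
Proof.
have wlog_lt (k l : 'I_n) : (k < l)%N -> max_abs sigma k = max_abs sigma l ->
    lt_letter (cur_letter sigma k) (next_letter sigma k) !=
      lt_letter (cur_letter sigma l) (next_letter sigma l).
  move=> lt_kl; rewrite !max_absE => eq_max.
  have [lt_kn lt_ln] := (ltn_ord k, ltn_ord l).
  have neq_L c d : (c < d <= n)%N -> (L c).2 <> (L d).2.
    by case/andP=> lt_cd le_dn /abs_letter_inj eq_cd; lia.
  (* The only coincidence left between the two steps is that of [L k.+1] with [L l]. *)
  have neq1 := neq_L k l; have neq2 := neq_L k l.+1; have neq3 := neq_L k.+1 l.+1.
  have [lt_k def_l] : ((L k).2 < (L k.+1).2)%N /\ k.+1 = l.
    have eq_l : (L k.+1).2 = (L l).2 by lia.
    by split; [lia | apply: abs_letter_inj eq_l; lia].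
  have lt_l : ((L l.+1).2 < (L l).2)%N by have := abs_letter_neq l; lia.
  rewrite !cur_letterE !next_letterE lt_letter_max_right // lt_letter_max_left //.
  by rewrite def_l; case: ((L l).1 == 0)%N.
move=> eq_lt eq_max; apply/val_inj; case: (ltngtP i j) => // lt_ij.
  by have := wlog_lt _ _ lt_ij eq_max; rewrite eq_lt eqxx.
by have := wlog_lt _ _ lt_ij (esym eq_max); rewrite eq_lt eqxx.
Qed.

Lemma lt_letter_nextE (i : 'I_n) :
  lt_letter (next_letter sigma i) (cur_letter sigma i) =
  ~~ lt_letter (cur_letter sigma i) (next_letter sigma i).
Proof.
rewrite cur_letterE next_letterE; have := abs_letter_neq i.
rewrite neq_ltn => /orP[] lt_i.
  by rewrite lt_letter_max_left // lt_letter_max_right.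
by rewrite lt_letter_max_right // lt_letter_max_left // negbK.
Qed.

Lemma max_abs_bounds (i : 'I_n) : (0 < max_abs sigma i <= n)%N.
Proof.
have le_L k : (k <= n)%N -> ((L k).2 <= n)%N.
  by case: k => [|k] // lt_kn; rewrite /L /= (nth_word _ _ (Ordinal lt_kn)) /=.
rewrite max_absE geq_max !le_L ?(ltnW (ltn_ord i)) // andbT.
by have := abs_letter_neq i; lia.
Qed.

(** Injectivity ensures that passing from steps to the set of their maxima loses no factor. *)
Lemma prod_max_abs (K : comNzRingType) (f : nat -> K) (p : pred 'I_n) :
    {in p &, injective (max_abs sigma)} ->
  \prod_(k in [set k : 'I_n | [exists i, p i && (max_abs sigma i == k.+1)]])
    f k.+1 = \prod_(i | p i) f (max_abs sigma i).
Proof.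
(* The default [i] is never reached, since [max_abs] takes values from 1 to n. *)
move=> inj_p; pose m i : 'I_n := insubd i (max_abs sigma i).-1.
have mE i : (m i).+1 = max_abs sigma i.
  have /andP[max_gt0 max_le] := max_abs_bounds i.
  by rewrite val_insubd prednK // max_le prednK.
have -> : [set k : 'I_n | [exists i, p i && (max_abs sigma i == k.+1)]] =
    m @: [set i | p i].
  apply/setP => k; rewrite inE; apply/existsP/imsetP => [[i /andP[p_i]]|[j]].
    rewrite -mE => /eqP[/val_inj <-]; by exists i => //; rewrite inE.
  by rewrite inE => p_j ->; exists j; rewrite p_j -mE eqxx.
rewrite big_imset => [|i j]; last first.
  by rewrite !inE => pi pj /(congr1 (fun k : 'I_n => k.+1)); rewrite !mE; apply: inj_p.
by apply: eq_big => [i|i _]; rewrite ?inE ?mE.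
Qed.

Lemma path_weight_word (K : comNzRingType) (x y : nat -> K) :
  path_weight x y (0, 0)%N (word sigma) =
  (\prod_(k in descent_tops sigma) x k.+1) *
  (\prod_(k in ascent_tops sigma) y k.+1).
Proof.
rewrite /descent_tops /ascent_tops !prod_max_abs; last 2 first.
- by move=> i j /= lt_i lt_j; apply: max_abs_inj; rewrite [RHS]lt_j.
- move=> i j; rewrite !unfold_in !lt_letter_nextE => /negPf lt_i /negPf lt_j.
  by apply: max_abs_inj; rewrite lt_i.
rewrite path_weight_nth size_word mulrC.
rewrite (eq_bigr (fun i => edge_weight x y (cur_letter sigma i) (next_letter sigma i)));
  last by move=> i _; rewrite cur_letterE next_letterE.
rewrite (bigID (fun i => lt_letter (cur_letter sigma i) (next_letter sigma i))) /=.
congr (_ * _); apply: eq_big => // i.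
- by rewrite /edge_weight => ->.
- by rewrite lt_letter_nextE.
by rewrite /edge_weight => /negPf ->.
Qed.

(** The left side runs over positions and the right side over letters; the permutation reindexes one
    as the other. *)
Lemma color_weight_word (K : comNzRingType) (q : nat -> K) :
  color_weight q (word sigma) = \prod_(k < n) q k.+1 ^+ color_mult sigma k.
Proof.
rewrite /color_weight big_map big_enum /= [RHS](reindex_inj (@perm_inj _ sigma.1)).
by apply: eq_bigr => j _; rewrite /color_mult permK.
Qed.

End EulerianWord.

(** * Evaluation at a point and stability *)

Theorem theorem3p16 (R : realType) (n r : nat) (hn : (1 <= n)%N) (hr : (1 <= r)%N)
    (q : 'I_n -> R) (hq : forall i : 'I_n, 0 <= q i) :
  real_stable (Eulerian_poly r q).
Proof.
(* [ord] sends the letter [k] to its index; 0 and numbers above n go to the index of letter 1, so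
   the sign conditions hold for all naturals. *)
right=> z z_gt0; pose ord k : 'I_n := insubd (Ordinal hn) k.-1.
have ordK (k : 'I_n) : ord k.+1 = k by apply: val_inj; rewrite val_insubd /= ltn_ord.
have evalX (A : {set 'I_n}) (h : 'I_n -> 'I_(n + n)) :
    (map_mpoly (real_complex R) (\prod_(k in A) 'X_(h k))).@[z] =
    \prod_(k in A) z (h k).
  rewrite (rmorph_prod (map_mpoly (real_complex R))) rmorph_prod.
  by apply: eq_bigr => k _; rewrite /= map_mpolyX mevalXU.
suff -> : (map_mpoly (real_complex R) (Eulerian_poly r q)).@[z] =
    word_sum (fun k => real_complex R (q (ord k))) (fun k => z (lshift n (ord k)))
      (fun k => z (rshift n (ord k))) n r.
  exact: word_sum_neq0.
rewrite /Eulerian_poly /word_sum (raddf_sum (map_mpoly (real_complex R))) raddf_sum.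
apply: eq_bigr => sigma _ /=.
rewrite color_weight_word path_weight_word map_mpolyZ mevalZ !rmorphM /=.
rewrite !evalX rmorph_prod; congr (_ * (_ * _)); apply: eq_bigr => k _.
- by rewrite rmorphXn ordK.
- by rewrite ordK.
by rewrite ordK.
Qed.
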